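(* For every $n\geq 1$, $$\sum_{e\in \mathbf{I}_n(>,\neq,>)} t^{\mathrm{asc}(e)}=\sum_{k=0}^{\lfloor (n-1)/2\rfloor}\bigl|\widetilde{\mathbf{I}_{n,k}}(>,\neq,>)\bigr|\,t^k(1+t)^{n-1-2k}.$$ In particular, $\sum_{e\in \mathbf{I}_n(>,\neq,>)} t^{\mathrm{asc}(e)}=\sum_{e\in \mathbf{I}_n(>,\neq,>)} t^{\,n-1-\mathrm{asc}(e)}$.
   Context: An inversion sequence of length $n$ is a word $e=e_1\cdots e_n$ of nonnegative integers with $0\leq e_i\leq i-1$ for all $i\in[n]$; $\mathbf{I}_n$ denotes the set of them. $\mathbf{I}_n(>,\neq,>)$ is the set of $e\in\mathbf{I}_n$ with no indices $i<j<k$ such that $e_i>e_j$, $e_j\neq e_k$ and $e_i>e_k$ (equivalently, $e$ avoids the patterns $201$ and $210$). $\mathrm{Asc}(e)=\{i\in[n-1]: e_i<e_{i+1}\}$ and $\mathrm{asc}(e)=|\mathrm{Asc}(e)|$. An index $i\in[n-2]$ is a double ascent of $e$ if $\{i,i+1\}\subseteq\mathrm{Asc}(e)$. $\widetilde{\mathbf{I}_{n,k}}(>,\neq,>)$ is the set of $e\in\mathbf{I}_n(>,\neq,>)$ with $\mathrm{asc}(e)=k$, no double ascents, and $e_{n-1}\geq e_n$. *)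

(* Defs.v *)
From mathcomp Require Import all_boot all_order all_algebra.

Set Implicit Arguments.
Unset Strict Implicit.
Unset Printing Implicit Defensive.

(* Positions are 0-based: the paper's letter e_(i+1) is [e i], so its bound    *)
(* e_(i+1) <= i reads [e i <= i].  All letters are < n, hence the codomain     *)
(* 'I_n, which loses no inversion sequence and makes the set finite.           *)
Definition inv_seq n : {set {ffun 'I_n -> 'I_n}} :=
  [set e : {ffun 'I_n -> 'I_n} | [forall i : 'I_n, e i <= i]].

(* I_n(>, !=, >) *)
Definition inv_seq_gng n : {set {ffun 'I_n -> 'I_n}} :=
  [set e in inv_seq n |
    ~~ [exists i : 'I_n, exists j : 'I_n, exists k : 'I_n,
          [&& i < j, j < k, e i > e j, e j != e k & e i > e k]]].

(* The witness [j] is the successor position of [i]; in particular the last    *)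
(* position is never an ascent.                                                *)
Definition Asc n (e : {ffun 'I_n -> 'I_n}) : {set 'I_n} :=
  [set i : 'I_n | [exists j : 'I_n, (j == i.+1 :> nat) && (e i < e j)]].

Definition asc n (e : {ffun 'I_n -> 'I_n}) : nat := #|Asc e|.

Definition double_ascent n (e : {ffun 'I_n -> 'I_n}) (i : 'I_n) : bool :=
  [exists j : 'I_n, [&& j == i.+1 :> nat, i \in Asc e & j \in Asc e]].

(* The paper's condition e_(n-1) >= e_n; it is vacuous for n = 1, where there  *)
(* is no letter e_(n-1).                                                       *)
Definition last_weak_descent n (e : {ffun 'I_n -> 'I_n}) : bool :=
  [forall i : 'I_n, forall j : 'I_n,
     (i.+1 == j :> nat) && (j.+1 == n) ==> (e i >= e j)].

Definition inv_seq_gng_tilde n k : {set {ffun 'I_n -> 'I_n}} :=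
  [set e in inv_seq_gng n |
    [&& asc e == k, ~~ [exists i : 'I_n, double_ascent e i]
      & last_weak_descent e]].

(* Main.v *)
Require Import Defs.
From mathcomp Require Import all_boot all_order all_algebra.
From mathcomp Require Import zify ring.
Import GRing.Theory.

Set Implicit Arguments.
Unset Strict Implicit.
Unset Printing Implicit Defensive.

Local Open Scope ring_scope.

(** A prefix of a sequence in I_n(>,!=,>) can be continued in a way that
    depends only on the pair (a, c), where a is the number of admissible
    letters smaller than its last letter and c + 1 the number of admissible
    larger ones.  In these terms a weak descent and an ascent are the linear
    operators
      D f(a, c) = f(a, c+1) + a f(0, c+2),
      A f(a, c) = sum_(j <= c) f(a+1+j, c-j).
    Weight the word of steps of a sequence by p for every ascent followed by a
    weak descent, u for every other ascent and w for every other weak descent,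
    and let F_m(a, c) be the total weight of the continuations of length m.
    The operator H f(a, c) = a f(0, c+2) - c f(a, c+1) satisfies
      [H, D] = D D,   [H, A] = D A - A D - A A,   H 1 = (D - A) 1,
    and it follows that along the line u + w = s one has dF_(m+1)/dw = H F_m.
    As H f(0, 0) = 0, the sum F_m(0, 0) over all sequences depends on p and
    u + w only.  For p = t and u + w = 1 + t, the choice w = 1 gives t^asc,
    the choice w = t gives t^(n-1-asc), and w = 1 + t, where u = 0 kills all
    sequences with a double or a final ascent, gives the gamma expansion. *)

(** * The step operators *)

Section StepOperators.

Variable R : comNzRingType.
Implicit Type f : nat -> nat -> R.

Definition stepD f (a c : nat) : R := f a c.+1 + a%:R * f 0%N c.+2.
Definition stepA f (a c : nat) : R := \sum_(j < c.+1) f (a + j.+1)%N (c - j)%N.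
Definition hop f (a c : nat) : R := a%:R * f 0%N c.+2 - c%:R * f a c.+1.

Lemma eq_stepD f g : f =2 g -> stepD f =2 stepD g.
Proof. by move=> fg a c; rewrite /stepD !fg. Qed.

Lemma eq_stepA f g : f =2 g -> stepA f =2 stepA g.
Proof. by move=> fg a c; apply: eq_bigr => j _; rewrite fg. Qed.

Lemma eq_hop f g : f =2 g -> hop f =2 hop g.
Proof. by move=> fg a c; rewrite /hop !fg. Qed.

Lemma stepD_linear (x y z : R) f g h a c :
  stepD (fun b d => x * f b d + y * g b d + z * h b d) a c =
  x * stepD f a c + y * stepD g a c + z * stepD h a c.
Proof. by rewrite /stepD; ring. Qed.

Lemma stepA_linear (x y z : R) f g h a c :
  stepA (fun b d => x * f b d + y * g b d + z * h b d) a c =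
  x * stepA f a c + y * stepA g a c + z * stepA h a c.
Proof. by rewrite /stepA !big_split /= !mulr_sumr. Qed.

Lemma hop_linear (x y z : R) f g h a c :
  hop (fun b d => x * f b d + y * g b d + z * h b d) a c =
  x * hop f a c + y * hop g a c + z * hop h a c.
Proof. by rewrite /hop; ring. Qed.

Lemma stepA_sub f g a c :
  stepA (fun b d => f b d - g b d) a c = stepA f a c - stepA g a c.
Proof. by rewrite /stepA sumrB. Qed.

Lemma hop_stepD f a c :
  hop (stepD f) a c = stepD (hop f) a c + stepD (stepD f) a c.
Proof. by rewrite /hop /stepD; ring. Qed.

Lemma sum_triangle (F : nat -> R) n :
  \sum_(i < n) \sum_(k < n - i) F (i + k).+1 = \sum_(j < n.+1) j%:R * F j.
Proof.
elim: n => [|n IHn]; first by rewrite big_ord0 big_ord1 mul0r.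
rewrite big_ord_recr /= [RHS]big_ord_recr /= -IHn subSnn big_ord1 addn0.
rewrite (eq_bigr (fun i : 'I_n => \sum_(k < n - i) F (i + k).+1 + F n.+1)).
  by rewrite big_split /= sumr_const card_ord -mulr_natl -[n.+1%:R]natr1; ring.
move=> i _; rewrite subSn ?(ltnW (ltn_ord i))// big_ord_recr /= subnKC //.
exact: ltnW.
Qed.

(** Two ascents that together raise a by j + 1 split in j ways, whence the factor j. *)
Lemma stepA_stepA f a c :
  stepA (stepA f) a c = \sum_(j < c.+2) j%:R * f (a + j.+1)%N (c.+1 - j)%N.
Proof.
rewrite -(sum_triangle (fun j => f (a + j.+1)%N (c.+1 - j)%N)) /stepA.
apply: eq_bigr => -[i ltic] _ /=; rewrite subSn //.
by apply: eq_bigr => k _; congr f; lia.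
Qed.

(** Everything rests on [hop f a c - stepD f a c] being -(c + 1) f(a, c + 1). Under [stepA] this
    leaves coefficients -(c + 1 - j), which the -j from [stepA_stepA] completes to the constant -(c
    + 1). *)
Lemma hop_stepA f a c :
  hop (stepA f) a c = stepA (hop f) a c + stepD (stepA f) a c
                      - stepA (stepD f) a c - stepA (stepA f) a c.
Proof.
have eqB : stepA (hop f) a c - stepA (stepD f) a c
    = - \sum_(j < c.+2) (c.+1%:R - j%:R) * f (a + j.+1)%N (c.+1 - j)%N.
  rewrite /stepA -sumrB [in RHS]big_ord_recr /= subrr mul0r addr0 -sumrN.
  apply: eq_bigr => j _; rewrite /hop /stepD.
  have le_jc : (j <= c)%N by rewrite -ltnS.
  by rewrite subSn // natrB // -natr1; ring.
rewrite [RHS](_ : _ = stepD (stepA f) a c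
   + (stepA (hop f) a c - stepA (stepD f) a c) - stepA (stepA f) a c); last by ring.
rewrite eqB stepA_stepA -addrA -opprD -big_split /=.
under eq_bigr do rewrite -mulrDl subrK.
by rewrite -mulr_sumr /hop /stepD -/(stepA f a c.+1) -natr1; ring.
Qed.

Variables u w q : R.

(* The second component sums over the words that start with a weak descent,
   leaving that step unweighted; [q] is the excess weight p - u w of an ascent
   followed by a weak descent. *)
Fixpoint step_sums m : (nat -> nat -> R) * (nat -> nat -> R) :=
  if m is m'.+1 then
    let: (f, g) := step_sums m' in
    (fun a c => w * stepD f a c + u * stepA f a c + q * stepA g a c, stepD f)
  else (fun _ _ => 1, fun _ _ => 0).

Definition words_sum m := (step_sums m).1.
Definition Dwords_sum m := (step_sums m).2.

Lemma words_sumS m a c :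
  words_sum m.+1 a c = w * stepD (words_sum m) a c + u * stepA (words_sum m) a c
                       + q * stepA (Dwords_sum m) a c.
Proof. by rewrite /words_sum /Dwords_sum /=; case: (step_sums m). Qed.

Lemma Dwords_sumS m a c : Dwords_sum m.+1 a c = stepD (words_sum m) a c.
Proof. by rewrite /words_sum /Dwords_sum /=; case: (step_sums m). Qed.

End StepOperators.

(** * Independence of the choice of w on the line u + w = s *)

Section Linearity.

Variables (R S : comNzRingType) (h : {additive R -> S}).

Lemma additive_stepD f a c :
  h (stepD f a c) = stepD (fun a c => h (f a c)) a c.
Proof. by rewrite /stepD raddfD /= !mulr_natl raddfMn. Qed.

Lemma additive_stepA f a c :
  h (stepA f a c) = stepA (fun a c => h (f a c)) a c.
Proof. by rewrite /stepA raddf_sum. Qed.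

End Linearity.

Section Invariance.

Variables (R : comNzRingType) (s p : R).

Let u : {poly R} := s%:P - 'X.
Let w : {poly R} := 'X.
Let q : {poly R} := p%:P - u * w.
Let f := words_sum u w q.
Let g := Dwords_sum u w q.

(** Joint induction: the product rule produces derivatives of level m, which the hypothesis turns
    into [hop] terms, and the commutators bring [hop] to the front. The second claim needs only
    [H, D] = D D. *)
Lemma deriv_words_sum m a c :
  (f m.+1 a c)^`() = hop (f m) a c /\
  (g m.+1 a c)^`() = hop (g m) a c - stepD (g m) a c.
Proof.
have du : u^`() = -1 by rewrite /u derivB derivC derivX sub0r.
have dw : w^`() = 1 by rewrite /w derivX.
have dq : q^`() = w - u.
  by rewrite /q derivB derivM derivC du dw; ring.
have dfS k b d : (f k.+1 b d)^`() =
    stepD (f k) b d - stepA (f k) b d + (w - u) * stepA (g k) b d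
    + w * stepD (fun b d => (f k b d)^`()) b d
    + u * stepA (fun b d => (f k b d)^`()) b d
    + q * stepA (fun b d => (g k b d)^`()) b d.
  rewrite /f /g words_sumS !derivD !derivM du dw dq.
  rewrite (additive_stepD deriv) !(additive_stepA deriv); ring.
have dgS k b d : (g k.+1 b d)^`() = stepD (fun b d => (f k b d)^`()) b d.
  by rewrite /f /g Dwords_sumS (additive_stepD deriv).
elim: m a c => [|m IHm] a c.
  have A0 : stepA (fun _ _ => 0 : {poly R}) a c = 0 by rewrite /stepA big1.
  have d1 b d : (f 0 b d)^`() = 0 by apply: derivC.
  have d0 b d : (g 0 b d)^`() = 0 by apply: derivC.
  rewrite dfS dgS (eq_stepD d1) (eq_stepA d1) (eq_stepA d0) A0.
  (* The base case is (a + 1) - (c + 1) = a - c. *)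
  have -> : stepA (f 0) a c = c.+1%:R by rewrite /stepA sumr_const card_ord.
  rewrite /stepD /hop -natr1.
  by split; rewrite /f /g /words_sum /Dwords_sum /=; ring.
have Ef b d : (f m.+1 b d)^`() = hop (f m) b d by case: (IHm b d).
have Eg b d : (g m.+1 b d)^`() = hop (g m) b d - stepD (g m) b d.
  by case: (IHm b d).
split.
  rewrite dfS (eq_stepD Ef) (eq_stepA Ef) (eq_stepA Eg) stepA_sub.
  rewrite (eq_stepA (Dwords_sumS u w q m)).
  rewrite (eq_hop (words_sumS u w q m)) (eq_stepD (words_sumS u w q m)).
  rewrite (eq_stepA (words_sumS u w q m)) stepD_linear stepA_linear hop_linear.
  by rewrite !hop_stepD !hop_stepA -/f -/g; ring.
rewrite dgS (eq_stepD Ef) (eq_hop (Dwords_sumS u w q m)).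
by rewrite (eq_stepD (Dwords_sumS u w q m)) hop_stepD addrK.
Qed.

Lemma horner_words_sum (x : R) m a c :
  (f m a c).[x] = words_sum (s - x) x (p - (s - x) * x) m a c /\
  (g m a c).[x] = Dwords_sum (s - x) x (p - (s - x) * x) m a c.
Proof.
elim: m a c => [|m IHm] a c; first by rewrite /= hornerC horner0.
have Ef b d : (f m b d).[x] = words_sum (s - x) x (p - (s - x) * x) m b d.
  by case: (IHm b d).
have Eg b d : (g m b d).[x] = Dwords_sum (s - x) x (p - (s - x) * x) m b d.
  by case: (IHm b d).
have hD F : (stepD F a c).[x] = stepD (fun b d => (F b d).[x]) a c.
  exact: (additive_stepD (horner_eval x)).
have hA F : (stepA F a c).[x] = stepA (fun b d => (F b d).[x]) a c.
  exact: (additive_stepA (horner_eval x)).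
split; last by rewrite /g !Dwords_sumS hD (eq_stepD Ef).
rewrite /f !words_sumS !hornerD !hornerM hD !hA.
rewrite (eq_stepD Ef) (eq_stepA Ef) (eq_stepA Eg).
by rewrite /q /u /w !(hornerD, hornerN, hornerM, hornerC, hornerX).
Qed.

End Invariance.

(** Integer coefficients let the factor i + 1 be cancelled, so only the constant term survives. *)
Lemma deriv_eq0_horner (P : {poly {poly int}}) x y : P^`() = 0 -> P.[x] = P.[y].
Proof.
move=> dP0; rewrite [P]size1_polyC ?hornerC //; apply/leq_sizeP => -[//|i] _.
apply/polyP => j; have /(congr1 (fun Q : {poly {poly int}} => Q`_i`_j)) := dP0.
rewrite coef_deriv coefMn !coef0 => /eqP.
by rewrite Num.Theory.mulrn_eq0 => /eqP.
Qed.

(** Both sides are values of one polynomial in w; at (0, 0) both coefficients of [hop] vanish, so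
    its derivative is zero. *)
Lemma words_sum_inv (s p x y : {poly int}) m :
  words_sum (s - x) x (p - (s - x) * x) m 0 0
  = words_sum (s - y) y (p - (s - y) * y) m 0 0.
Proof.
have [<- _] := horner_words_sum s p x m 0 0.
have [<- _] := horner_words_sum s p y m 0 0.
apply: deriv_eq0_horner; case: m => [|m]; first exact: derivC.
by have [-> _] := deriv_words_sum s p m 0 0; rewrite /hop !mul0r subrr.
Qed.

(** * Weighted words of steps *)

Section Weights.

Variables (R : comNzRingType) (u w p : R).

(* In a word of steps, [true] is an ascent and [false] a weak descent. *)
Fixpoint steps_wt (sg : bitseq) : R :=
  match sg with
  | [::] => 1
  | false :: sg' => w * steps_wt sg'
  | true :: sg' =>
      if sg' is false :: sg'' then p * steps_wt sg'' else u * steps_wt sg'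
  end.

Definition steps_wtD (sg : bitseq) : R :=
  if sg is false :: sg' then steps_wt sg' else 0.

Lemma steps_wt_true sg :
  steps_wt (true :: sg) = u * steps_wt sg + (p - u * w) * steps_wtD sg.
Proof. by case: sg => [|[] sg] /=; ring. Qed.

End Weights.

(* [M] is the maximum of the current prefix, [k] its length, and [low] lists
   the admissible letters smaller than [M]; all letters from [M] to [k] are
   admissible. *)
Definition next_low (M : nat) (low : seq nat) (y : nat) :=
  if (y < M)%N then [:: y] else low ++ iota M (y - M).
Definition letters (M : nat) (low : seq nat) k := low ++ iota M (k.+1 - M).

Fixpoint completions m M low k : seq (seq nat) :=
  if m is m'.+1 then
    [seq y :: v | y <- letters M low k,
                  v <- completions m' (maxn M y) (next_low M low y) k.+1]
  else [:: [::]].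

(* [x] is the last letter of the prefix, and (a, c) is the pair that determines
   its continuations. *)
Definition state (x M : nat) (low : seq nat) (k a c : nat) : Prop :=
  (M < k)%N /\
  ([/\ x = M, all (fun y => y < M)%N low, a = size low & k = (M + c).+1] \/
   [/\ (x < M)%N, low = [:: x], a = 0 & k = M + c])%N.

Lemma sum_seq_pred0 (V : nmodType) (r : seq nat) (P : pred nat) (F : nat -> V) :
  {in r, forall y, ~~ P y} -> \sum_(y <- r | P y) F y = 0.
Proof.
move=> r0; rewrite big_seq_cond big_pred0 // => y.
by case: (boolP (y \in r)) => //= /r0/negPf.
Qed.

Section OneStep.

Variables (R : comNzRingType) (x M : nat) (low : seq nat) (k a c : nat).
Hypothesis st : state x M low k a c.
Variables (Phi : nat -> nat -> seq nat -> R) (phi : nat -> nat -> R).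
Hypothesis Phi_phi : forall y N l a' c',
  state y N l k.+1 a' c' -> Phi y N l = phi a' c'.

(** If the last letter is [M], repeating it leads to (a, c + 1), and each of the a lower letters
    leads to (0, c + 2). If it is below [M], it can only be repeated, and a = 0. *)
Lemma sum_letters_le :
  \sum_(y <- letters M low k | (y <= x)%N) Phi y (maxn M y) (next_low M low y)
  = stepD phi a c.
Proof.
case: st => ltMk [[-> alow -> ek]|[ltxM -> -> ek]].
- rewrite /letters big_cat /= subSn 1?ltnW //= big_cons leqnn /=.
  rewrite [X in _ + (_ + X)]sum_seq_pred0 => [|y]; last first.
    by rewrite mem_iota; lia.
  rewrite addr0 addrC /stepD; congr (_ + _).
    apply: Phi_phi; rewrite /next_low ltnn subnn cats0 maxnn; split; first lia.
    by left; split=> //; lia.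
  rewrite big_seq_cond (eq_bigr (fun=> phi 0%N c.+2)) => [|y /andP[yl _]].
    rewrite -big_seq_cond big_const_seq iter_addr_0 mulr_natl -size_filter.
    congr (_ *+ size _); rewrite -[RHS]filter_predT.
    by apply: eq_in_filter => y yl /=; rewrite ltnW ?(allP alow).
  have ltyM := allP alow _ yl.
  rewrite /next_low ltyM (maxn_idPl (ltnW ltyM)); apply: Phi_phi.
  by split; [lia | right; split=> //; lia].
- rewrite /letters big_cons leqnn /=.
  rewrite [X in _ + X]sum_seq_pred0 => [|y]; last first.
    by rewrite mem_iota; lia.
  rewrite /stepD mul0r !addr0 /next_low ltxM (maxn_idPl (ltnW ltxM)).
  by apply: Phi_phi; split; [lia | right; split=> //; lia].
Qed.

(** The larger admissible letters form an interval of c + 1 integers. Choosing the one with j others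
    below it makes it the maximum, with a + j + 1 admissible letters under it. *)
Lemma sum_letters_gt :
  \sum_(y <- letters M low k | (x < y)%N) Phi y (maxn M y) (next_low M low y)
  = stepA phi a c.
Proof.
(* [N] is the least admissible letter above [x]: M + 1 if x = M, and M if x < M. *)
have sumI N d : (M <= N)%N -> (x < N)%N -> (N + d = k.+1)%N -> d = c.+1 ->
   (size low + (N - M) = a.+1)%N ->
   all (fun y => y < M)%N low ->
  \sum_(y <- iota N d | (x < y)%N) Phi y (maxn M y) (next_low M low y)
  = stepA phi a c.
  move=> leMN ltxN eNd ed elow alow; subst d.
  rewrite big_seq_cond (eq_bigl (fun y => y \in iota N c.+1)) => [|y]; last first.
    by rewrite mem_iota; lia.
  rewrite -big_seq -{1}[N]addn0 iotaDl big_map -[iota 0 _]/(index_iota 0 c.+1).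
  rewrite big_mkord; apply: eq_bigr => -[j ltj] _ /=.
  have leMy : (M <= N + j)%N by lia.
  rewrite (maxn_idPr leMy) /next_low ltnNge leMy /=; apply: Phi_phi.
  split; first lia; left; split=> //; last by lia.
    rewrite all_cat; apply/andP; split; last by apply/allP => y; rewrite mem_iota; lia.
    by apply: sub_all alow => y; lia.
  by rewrite size_cat size_iota; lia.
case: st => ltMk [[eqx alow ea ek]|[ltxM elow ea ek]].
- rewrite /letters big_cat /= subSn 1?ltnW //= big_cons.
  rewrite (_ : x < M = false)%N /=; last by lia.
  rewrite [X in X + _]sum_seq_pred0 => [|y]; last first.
    by move/(allP alow); lia.
  by rewrite add0r sumI //; lia.
- rewrite /letters big_cat /= [X in X + _]sum_seq_pred0 => [|y]; last first.
    by rewrite elow inE; lia.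
  by rewrite add0r sumI //= ?elow /=; lia.
Qed.

End OneStep.

Section WordSums.

Variables (R : comNzRingType) (u w p : R).

Lemma sum_completions m x M low k a c : state x M low k a c ->
  \sum_(v <- completions m M low k) steps_wt u w p (pairmap ltn x v)
    = words_sum u w (p - u * w) m a c
  /\ \sum_(v <- completions m M low k) steps_wtD u w p (pairmap ltn x v)
    = Dwords_sum u w (p - u * w) m a c.
Proof.
elim: m x M low k a c => [|m IHm] x M low k a c st.
  by rewrite /= !big_seq1.
pose F y N l := \sum_(v <- completions m N l k.+1) steps_wt u w p (pairmap ltn y v).
pose G y N l := \sum_(v <- completions m N l k.+1) steps_wtD u w p (pairmap ltn y v).
have EF y N l a' c' : state y N l k.+1 a' c' ->
  F y N l = words_sum u w (p - u * w) m a' c' by case/IHm.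
have EG y N l a' c' : state y N l k.+1 a' c' ->
  G y N l = Dwords_sum u w (p - u * w) m a' c' by case/IHm.
rewrite /= !big_allpairs_dep /=; split.
  rewrite words_sumS -(sum_letters_le st EF) -(sum_letters_gt st EF).
  rewrite -(sum_letters_gt st EG) (bigID (fun y => y <= x)%N) /=.
  rewrite -addrA; congr (_ + _).
    rewrite mulr_sumr; apply: eq_bigr => y leyx; rewrite mulr_sumr.
    by apply: eq_bigr => v _; rewrite ltnNge leyx.
  rewrite !mulr_sumr -big_split /=.
  apply: eq_big => [y|y]; rewrite -ltnNge // => ltxy.
  rewrite !mulr_sumr -big_split /=.
  by apply: eq_bigr => v _; rewrite ltxy -steps_wt_true.
rewrite Dwords_sumS -(sum_letters_le st EF) (bigID (fun y => y <= x)%N) /=.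
rewrite [X in _ + X]big1 ?addr0 => [|y].
  apply: eq_bigr => y leyx.
  by apply: eq_bigr => v _; rewrite ltnNge leyx.
by rewrite -ltnNge => ltxy; rewrite big1 // => v _; rewrite ltxy.
Qed.

End WordSums.

(** * Isolated ascents and special values of the weights *)

Definition not_both (x y : bool) := ~~ (x && y).

(* The appended [true] excludes a final ascent. *)
Definition ascents_isolated (sg : bitseq) := path not_both false (rcons sg true).

(** Each ascent owns the weak descent after it. After a preceding ascent the first letter of the
    word is already owned, hence the strict bound. *)
Lemma ascents_isolated_count sg :
  (ascents_isolated sg -> (2 * count id sg <= size sg)%N) /\
  (path not_both true (rcons sg true) -> (2 * count id sg < size sg)%N).
Proof.
elim: sg => [|[] sg [IH0 IH1]]; rewrite /ascents_isolated //=.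
  by split=> // /IH1; lia.
by split=> /IH0; lia.
Qed.

Section WeightValues.

Variable R : comNzRingType.

(** For p = u w the excess weight vanishes and the weight is multiplicative. *)
Lemma steps_wt_mul (u w : R) sg :
  steps_wt u w (u * w) sg = u ^+ count id sg * w ^+ (size sg - count id sg).
Proof.
have := count_size id sg.
elim: sg => [|b sg IH] /=; first by rewrite !expr0 mulr1.
have le_sg := count_size id sg; case: b => _.
  rewrite -/(steps_wt u w (u * w) (true :: sg)) steps_wt_true subrr IH //.
  by rewrite exprS subSS; ring.
by rewrite IH // add0n subSn // exprS; ring.
Qed.

Lemma steps_wt_isolated (w p : R) sg :
  steps_wt 0 w p sg =
    (ascents_isolated sg)%:R * (p ^+ count id sg * w ^+ (size sg - 2 * count id sg)).
Proof.
(* The second clause treats what follows an ascent; the shifted exponents include that ascent. *)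
suff: steps_wt 0 w p sg =
    (ascents_isolated sg)%:R * (p ^+ count id sg * w ^+ (size sg - 2 * count id sg))
  /\ p * steps_wtD 0 w p sg = (path not_both true (rcons sg true))%:R *
    (p ^+ (count id sg).+1 * w ^+ ((size sg).+1 - 2 * (count id sg).+1)) by case.
elim: sg => [|b sg [IH0 IH1]]; first by rewrite /= /ascents_isolated /=; split; ring.
case: b.
  split; last by rewrite /= mul0r mulr0.
  by rewrite steps_wt_true !mul0r subr0 add0r IH1.
have [iso _] := ascents_isolated_count sg.
rewrite /ascents_isolated /= -/(ascents_isolated sg) add0n.
rewrite IH0; case: (ascents_isolated sg) iso => iso; last by rewrite !mul0r !mulr0.
rewrite !mul1r subSn ?iso // !exprS.
have -> : ((size sg).+2 - 2 * (count id sg).+1 = size sg - 2 * count id sg)%N by lia.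
by split; ring.
Qed.

End WeightValues.

(** * Continuations of a prefix and avoidance *)

Local Open Scope nat_scope.

Definition gng_upto (e : nat -> nat) n :=
  (forall i, i < n -> e i <= i) /\
  (forall i j l, i < j -> j < l -> l < n -> e j < e i -> e l < e i -> e j = e l).

Lemma gng_uptoW e n n' : n' <= n -> gng_upto e n -> gng_upto e n'.
Proof.
move=> le_n [bnd av]; split=> [i lti|i j l lij ljl lln].
  by apply: bnd; apply: leq_trans le_n.
by apply: av => //; apply: leq_trans le_n.
Qed.

Lemma eq_gng_upto e e' n :
  (forall i, i < n -> e i = e' i) -> gng_upto e n -> gng_upto e' n.
Proof.
move=> ee' [bnd av]; split=> [i lti|i j l lij ljl lln].
  by rewrite -ee' // bnd.
by rewrite -!ee'; [exact: av | lia..].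
Qed.

(** Only the pattern condition; the bound y <= k is imposed by [letters]. *)
Definition letter_ok (e : nat -> nat) k y :=
  forall i j, i < j -> j < k -> e j < e i -> y < e i -> e j = y.

Lemma gng_uptoS e k :
  gng_upto e k.+1 <-> [/\ gng_upto e k, e k <= k & letter_ok e k (e k)].
Proof.
split=> [gk|[[bnd av] lek ok]].
  split; [exact: gng_uptoW gk | by case: gk => + _; apply |].
  by case: gk => _ av i j lij ljk; apply: av.
split=> [i|i j l lij ljl]; rewrite ltnS leq_eqVlt.
  by case/orP => [/eqP->|/bnd].
by case/orP => [/eqP el|]; [subst l; apply: ok | apply: av].
Qed.

Definition prefix_state (e : nat -> nat) k M low :=
  [/\ forall i, i < k -> e i <= M, exists2 i, i < k & e i = M, M < k,
      all (fun y => y < M) low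
    & forall y, M <= y \/ y \in low <-> letter_ok e k y].

Lemma mem_letters e k M low : prefix_state e k M low ->
  (e k \in letters M low k) <-> (e k <= k /\ letter_ok e k (e k)).
Proof.
case=> _ _ ltMk alow <-; rewrite mem_cat mem_iota subnKC; last by lia.
split=> [/orP[kl|/andP[leM ltk]]|[lek [leM|->//]]].
- by have := allP alow _ kl; split; [lia | right].
- by split; [lia | left].
- by rewrite leM ltnS lek orbT.
Qed.

Lemma prefix_stateS e k M low : prefix_state e k M low -> gng_upto e k.+1 ->
  prefix_state e k.+1 (maxn M (e k)) (next_low M low (e k)).
Proof.
case=> leM [i0 lti0 ei0] ltMk alow lowP /gng_uptoS[_ lek okk].
(* The new letter can only be the middle of a pattern ending in y, and the maximum [M] is the most
   restrictive first letter. *)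
have okS y : letter_ok e k.+1 y <->
    letter_ok e k y /\ (e k < M -> y < M -> e k = y).
  split=> [ok|[ok ok']].
    split=> [i j lij ljk|ekM yM]; first by apply: ok; lia.
    by apply: (ok i0 k) => //; rewrite ei0.
  move=> i j lij; rewrite ltnS leq_eqVlt => /orP[/eqP ej|ljk]; last exact: ok.
  by subst j => li ly; have := leM _ lij => leiM; apply: ok'; lia.
split.
- move=> i; rewrite ltnS leq_eqVlt => /orP[/eqP->|/leM]; lia.
- case: (leqP (e k) M) => [leekM|ltMek].
    by exists i0 => //; apply: ltnW.
  by exists k.
- lia.
- rewrite /next_low; case: ltnP => [ltekM|leMek] /=; first by rewrite ltekM.
  rewrite all_cat; apply/andP; split; last by apply/allP => y; rewrite mem_iota; lia.
  by apply: sub_all alow => y; lia.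
move=> y; rewrite okS -lowP /next_low; case: ltnP => [ltekM|leMek].
  rewrite inE; split.
    case=> [leMy|/eqP->]; first by split; [left | lia].
    by split=> //; rewrite lowP.
  by case=> _ h; case: (leqP M y) => [|/(h isT)->]; [left | right].
rewrite mem_cat mem_iota; split.
  case=> [leky|/orP[yl|]]; first by split; [left|]; lia.
    by split; [right | lia].
  by move=> h; split; [left|]; lia.
case=> -[leMy|yl] _; last by right; rewrite yl.
by case: (leqP (e k) y) => h; [left | right; apply/orP; right; lia].
Qed.

Lemma mem_completions m e k M low : gng_upto e k -> prefix_state e k M low ->
  (map e (iota k m) \in completions m M low k) <-> gng_upto e (k + m).
Proof.
elim: m k M low => [|m IHm] k M low gk st; first by rewrite addn0 inE.
have okP := mem_letters st.
rewrite addnS -addSn; split=> [/allpairsPdep[y [v [yl vl [ey ev]]]]|gkm].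
  subst y v; have [lek okk] := iffLR okP yl.
  have gkS : gng_upto e k.+1 by apply/gng_uptoS.
  by apply/(IHm _ _ _ gkS (prefix_stateS st gkS)).
have gkS : gng_upto e k.+1 by apply: gng_uptoW gkm; rewrite leq_addr.
have [_ lek okk] := iffLR (gng_uptoS e k) gkS.
apply/allpairsPdep; exists (e k), (map e (iota k.+1 m)); split=> //.
  exact/okP.
exact/(IHm _ _ _ gkS (prefix_stateS st gkS)).
Qed.

Lemma size_completions m M low k v : v \in completions m M low k -> size v = m.
Proof.
elim: m M low k v => [|m IHm] M low k v /=; first by rewrite inE => /eqP->.
by case/allpairsPdep=> y [v' [_ /IHm <- ->]].
Qed.

Lemma uniq_completions m M low k :
  uniq low -> all (fun y => y < M) low -> uniq (completions m M low k).
Proof.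
elim: m M low k => [//|m IHm] M low k ulow alow /=.
apply: allpairs_uniq_dep => [|y yl|[y v] [y' v'] _ _ [-> ->] //].
  rewrite cat_uniq ulow iota_uniq andbT /=; apply/hasPn => y.
  by rewrite mem_iota => /andP[leMy _]; apply/negP => /(allP alow); lia.
apply: IHm; rewrite /next_low; case: ltnP => //= hy.
- rewrite cat_uniq ulow iota_uniq andbT /=; apply/hasPn => z.
  by rewrite mem_iota => /andP[leMz _]; apply/negP => /(allP alow); lia.
- by rewrite hy.
rewrite all_cat; apply/andP; split; last by apply/allP => z; rewrite mem_iota; lia.
by apply: sub_all alow => z; lia.
Qed.

Lemma prefix_state1 e : e 0 = 0 -> prefix_state e 1 0 [::].
Proof.
move=> e0; split=> // [[|]//||y]; [by rewrite e0 | by exists 0 |].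
by split=> [_ i [|]//|_]; left.
Qed.

(** * Inversion sequences as finite functions *)

Section FiniteFunctions.

Variable m : nat.
Implicit Type e : {ffun 'I_m.+1 -> 'I_m.+1}.

Definition letter e (i : nat) : nat := e (inord i).

Lemma letterE e (i : 'I_m.+1) : letter e i = e i.
Proof. by rewrite /letter inord_val. Qed.

Lemma inv_seq_gngP e : e \in inv_seq_gng m.+1 <-> gng_upto (letter e) m.+1.
Proof.
rewrite !inE; split=> [/andP[/forallP bnd nex]|[bnd av]].
  split=> [i lti|i j l lij ljl lln lji lli].
    by have := bnd (Ordinal lti); rewrite -letterE.
  apply/eqP; apply: contraNT nex => nejl.
  have ltj := ltn_trans ljl lln; have lti := ltn_trans lij ltj.
  apply/existsP; exists (Ordinal lti); apply/existsP; exists (Ordinal ltj).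
  apply/existsP; exists (Ordinal lln); rewrite -(inj_eq val_inj) /= -!letterE /=.
  by rewrite lij ljl lji lli nejl.
apply/andP; split; first by apply/forallP => i; rewrite -letterE bnd.
apply/existsP => -[i /existsP[j /existsP[l]]].
rewrite -(inj_eq val_inj) /= -!letterE => /and5P[lij ljl lji nejl lli].
by case/eqP: nejl; apply: (av i j l).
Qed.

Lemma letter0 e : e \in inv_seq_gng m.+1 -> letter e 0 = 0.
Proof. by case/inv_seq_gngP => bnd _; apply/eqP; rewrite -leqn0 bnd. Qed.

Lemma letter_inj e e' :
  (forall i, i <= m -> letter e i = letter e' i) -> e = e'.
Proof.
move=> ee'; apply/ffunP => i; apply: val_inj; rewrite /= -!letterE.
by apply: ee'; rewrite -ltnS.
Qed.

(** The first letter is always 0, so it is dropped and the rest completes the prefix 0. *)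
Lemma perm_completions_gng :
  perm_eq [seq map (letter e) (iota 1 m) | e <- enum (inv_seq_gng m.+1)]
          (completions m 0 [::] 1).
Proof.
apply: uniq_perm.
- rewrite map_inj_in_uniq ?enum_uniq // => e e'.
  rewrite !mem_enum => ge ge' /eq_in_map eqee'; apply: letter_inj => -[_|i lti].
    by rewrite !letter0.
  by apply: eqee'; rewrite mem_iota.
- exact: uniq_completions.
move=> v; apply/mapP/idP => [[e]|vc].
  rewrite mem_enum => ge ->; have e0 := letter0 ge.
  apply/(mem_completions m _ (prefix_state1 e0)); last exact/inv_seq_gngP.
  by move/inv_seq_gngP: ge; apply: gng_uptoW.
(* [h] restores the dropped first letter. *)
have sv := size_completions vc; pose h := nth 0 (0 :: v).
have ev : v = map h (iota 1 m).
  by rewrite -[in RHS]add1n iotaDl -map_comp -[LHS](mkseq_nth 0) sv.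
have h0 : h 0 = 0 by [].
have gh : gng_upto h m.+1.
  apply/(mem_completions m _ (prefix_state1 h0)); last by rewrite -ev.
  by split=> [[|]//|i j [|]//].
pose e := [ffun i : 'I_m.+1 => inord (h i) : 'I_m.+1].
have eh i : i < m.+1 -> h i = letter e i.
  move=> lti; rewrite /letter ffunE !inordK //.
  by case: gh => /(_ i lti) le_h _; apply: leq_ltn_trans lti.
exists e; last first.
  rewrite [LHS]ev; apply/eq_in_map => i; rewrite mem_iota => /andP[_ lti].
  exact: eh.
by rewrite mem_enum; apply/inv_seq_gngP; apply: eq_gng_upto gh.
Qed.

Definition steps e := [seq letter e i < letter e i.+1 | i <- iota 0 m].

Lemma size_steps e : size (steps e) = m.
Proof. by rewrite size_map size_iota. Qed.

Lemma nth_steps e i :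
  nth false (steps e) i = (i < m) && (letter e i < letter e i.+1).
Proof.
case: ltnP => [ltim|leim]; last by rewrite nth_default ?size_steps.
by rewrite (nth_map 0) ?size_iota // nth_iota.
Qed.

Lemma pairmap_ltn_iota (h : nat -> nat) k l :
  pairmap ltn (h k) (map h (iota k.+1 l)) = [seq h i < h i.+1 | i <- iota k l].
Proof. by elim: l k => //= l IHl k; rewrite IHl. Qed.

Lemma mem_Asc e (i : 'I_m.+1) : (i \in Asc e) = nth false (steps e) i.
Proof.
rewrite inE nth_steps; apply/existsP/andP => [[j /andP[/eqP ej lij]]|[ltim lij]].
  by rewrite -ej !letterE; split=> //; have := ltn_ord j; rewrite ej ltnS.
by exists (inord i.+1); rewrite -!letterE inordK // eqxx.
Qed.

Lemma ascE e : asc e = count id (steps e).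
Proof.
rewrite /asc -sum1_card big_mkcond /=.
under eq_bigr do rewrite mem_Asc.
rewrite big_ord_recr /= nth_default ?size_steps // addn0.
rewrite -[steps e in RHS](mkseq_nth false) size_steps count_map -sum1_count.
by rewrite -[m in iota 0 m]subn0 -/(index_iota 0 m) big_mkord [RHS]big_mkcond.
Qed.

Lemma ascents_isolatedE e :
  ascents_isolated (steps e) =
  ~~ [exists i, double_ascent e i] && last_weak_descent e.
Proof.
(* Link 0 of the path starts at [false] and is trivial. Link i + 1 joins step i to step i + 1,
   excluding a double ascent, or to the appended [true] if i + 1 = m, excluding a final ascent. *)
apply/(pathP false)/andP => [iso|[/existsPn nda /forallP lwd] [|i]].
- split.
    apply/existsPn => i; apply/existsP => -[j /and3P[/eqP ej]].
    rewrite !mem_Asc ej => ai aj.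
    have ltim : i.+1 < m by move: aj; rewrite nth_steps => /andP[].
    have := iso i.+1; rewrite size_rcons size_steps ltnS ltnW // => /(_ isT).
    rewrite /= !nth_rcons size_steps ltim (ltnW ltim) /not_both.
    by rewrite ai aj.
  apply/forallP => i; apply/forallP => j; apply/implyP => /andP[/eqP ej /eqP ejm].
  have ltim : i < m by lia.
  have := iso i.+1; rewrite size_rcons size_steps ltnS ltim => /(_ isT).
  rewrite /= !nth_rcons size_steps ltim ifF; last by lia.
  rewrite ifT; last by lia.
  by rewrite /not_both andbT nth_steps ltim /= -leqNgt ej !letterE.
- by [].
rewrite size_rcons size_steps ltnS => ltim.
rewrite /= !nth_rcons size_steps ltim /not_both.
have [ltSi|ei] : i.+1 < m \/ i.+1 = m by lia.
  rewrite ltSi; apply: contra (nda (inord i)) => /andP[ai aSi].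
  have lti : i < m.+1 by lia.
  apply/existsP; exists (inord i.+1).
  by rewrite !mem_Asc !inordK ?eqxx ?ai //; lia.
have lti : i < m.+1 by lia.
have ltSi : i.+1 < m.+1 by lia.
rewrite ifF ?ifT ?andbT; [|lia..]; rewrite nth_steps ltim /= -leqNgt.
have /forallP/(_ (inord i.+1)) := lwd (inord i).
by rewrite -!letterE !inordK // eqxx eqSS ei eqxx.
Qed.

End FiniteFunctions.

(** * Generating functions and the gamma expansion *)

Local Open Scope ring_scope.

Lemma sum_gng_steps_wt (R : comNzRingType) (u w p : R) m :
  \sum_(e in inv_seq_gng m.+1) steps_wt u w p (steps e)
  = words_sum u w (p - u * w) m 0 0.
Proof.
have st : state 0 0 [::] 1 0 0 by split=> //; left.
have [<- _] := sum_completions u w p m st.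
rewrite -(perm_big _ (perm_completions_gng m)) /= big_map big_enum_cond /=.
apply: eq_big => [e|e ge]; first by rewrite andbT.
by rewrite -[X in pairmap _ X](letter0 ge) pairmap_ltn_iota.
Qed.

Lemma sum_gng_steps_wt_inv (s p x y : {poly int}) m :
  \sum_(e in inv_seq_gng m.+1) steps_wt (s - x) x p (steps e)
  = \sum_(e in inv_seq_gng m.+1) steps_wt (s - y) y p (steps e).
Proof. by rewrite !sum_gng_steps_wt; apply: words_sum_inv. Qed.

Lemma sum_tilde (R : comNzRingType) (F : nat -> R) m :
  \sum_(0 <= k < (m %/ 2).+1) #|inv_seq_gng_tilde m.+1 k|%:R * F k
  = \sum_(e in inv_seq_gng m.+1) (ascents_isolated (steps e))%:R * F (asc e).
Proof.
under [RHS]eq_bigr do rewrite mulr_natl mulrb.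
rewrite -big_mkcondr /= big_mkord.
rewrite (partition_big (fun e => inord (asc e) : 'I_(m %/ 2).+1) xpredT) //=.
apply: eq_bigr => k _; rewrite mulr_natl -sumr_const.
(* Isolation bounds [asc e] by m / 2, so [inord] does not alter it. *)
have leK (e : {ffun 'I_m.+1 -> 'I_m.+1}) :
    ascents_isolated (steps e) -> (asc e < (m %/ 2).+1)%N.
  have [+ _] := ascents_isolated_count (steps e).
  by move=> /[apply]; rewrite ascE size_steps ltnS leq_divRL // mulnC.
have tildeE (e : {ffun 'I_m.+1 -> 'I_m.+1}) :
    (e \in inv_seq_gng m.+1) && ascents_isolated (steps e)
    && (inord (asc e) == k) = (e \in inv_seq_gng_tilde m.+1 k).
  rewrite [RHS]inE -ascents_isolatedE -andbA; congr (_ && _).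
  rewrite andbC; case: (boolP (ascents_isolated _)) => [iso|_]; last by rewrite !andbF.
  by rewrite !andbT -(inj_eq val_inj) /= inordK ?leK.
apply: eq_big => [e|e]; first by rewrite tildeE.
by rewrite [in X in X -> _]inE => /and3P[_ /eqP-> _].
Qed.

Theorem theorem1p6 (n : nat) (hn : (1 <= n)%N) :
  (\sum_(e in inv_seq_gng n) 'X^(asc e) : {poly int}) =
    \sum_(0 <= k < ((n - 1) %/ 2).+1)
      #|inv_seq_gng_tilde n k|%:R * 'X^k * (1 + 'X) ^+ (n - 1 - 2 * k)
  /\
  (\sum_(e in inv_seq_gng n) 'X^(asc e) : {poly int}) =
    \sum_(e in inv_seq_gng n) 'X^(n - 1 - asc e).
Proof.
case: n hn => [//|m] _; rewrite subn1 /=.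
(* At s = 1 + t, p = t, w = 1 one has u = t, so p = u w. *)
have -> : (\sum_(e in inv_seq_gng m.+1) 'X^(asc e) : {poly int})
    = \sum_(e in inv_seq_gng m.+1) steps_wt (1 + 'X - 1) 1 'X (steps e).
  apply: eq_bigr => e _; rewrite addrAC subrr add0r.
  by rewrite -[X in steps_wt _ _ X _]mulr1 steps_wt_mul expr1n mulr1 ascE.
split.
  (* Here u = 0, so only words with isolated ascents contribute. *)
  rewrite (sum_gng_steps_wt_inv _ _ _ (1 + 'X)) subrr.
  under [RHS]eq_bigr do rewrite -mulrA.
  rewrite (sum_tilde (fun k => 'X^k * (1 + 'X) ^+ (m - 2 * k))).
  by apply: eq_bigr => e _; rewrite steps_wt_isolated size_steps ascE.
(* Here w = t and u = 1: again p = u w, but now weak descents are counted. *)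
rewrite (sum_gng_steps_wt_inv _ _ _ 'X) addrK; apply: eq_bigr => e _.
by rewrite -[X in steps_wt _ _ X _]mul1r steps_wt_mul expr1n mul1r size_steps ascE.
Qed.
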